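(* Let $(X,\|\cdot\|)$ be a normed space, $C\subseteq X$ a (nonempty) convex subset, and $T:C\to C$ a non-expansive map, i.e. $\|Tx-Ty\|\le\|x-y\|$ for all $x,y\in C$. Let $(\alpha_k)_{k\ge 1}$ be any sequence in $[0,1]$, let $x_0\in C$, and define $$x_k=(1-\alpha_k)x_{k-1}+\alpha_k Tx_{k-1}\qquad(k\ge 1).$$ Then for every $n\ge 1$, $$\|x_n-Tx_n\|\le \frac{\operatorname{diam}(C)}{\sqrt{\pi\sum_{i=1}^n\alpha_i(1-\alpha_i)}}.$$
   Context: Here $\operatorname{diam}(C)=\sup_{x,y\in C}\|x-y\|\in[0,+\infty]$. The right-hand side is read as $+\infty$ (so the inequality is vacuous) when $\sum_{i=1}^n\alpha_i(1-\alpha_i)=0$ or $\operatorname{diam}(C)=+\infty$. In the bound, $\pi$ is the usual constant $3.14159\ldots$. *)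

(* Defs.v *)
From HB Require Import structures.
From mathcomp Require Import all_boot all_order all_algebra.
From mathcomp Require Import all_classical all_reals all_analysis.

Set Implicit Arguments.
Unset Strict Implicit.
Unset Printing Implicit Defensive.

Import Order.TTheory GRing.Theory Num.Theory.
Import numFieldNormedType.Exports.

Local Open Scope classical_set_scope.
Local Open Scope ring_scope.

Definition diam (R : realType) (X : normedModType R) (C : set X) : \bar R :=
  ereal_sup [set `|p.1 - p.2|%:E | p in C `*` C].

(* [alpha 0] is never used: the step sizes are indexed from 1. *)
Fixpoint km_iter (R : realType) (X : normedModType R) (T : X -> X)
    (alpha : nat -> R) (x0 : X) (k : nat) : X :=
  if k is j.+1 then
    (1 - alpha k) *: km_iter T alpha x0 j + alpha k *: T (km_iter T alpha x0 j)
  else x0.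

(* The case [s = 0] is singled out because in [\bar R] one has
   [0 / 0 = 0 * +oo = 0], whereas the bound is meant to be [+oo] whenever
   [s = 0], even if [diam C = 0].  For [s > 0] and [diam C = +oo] the quotient
   is already [+oo]. *)
Definition km_bound (R : realType) (X : normedModType R) (C : set X) (s : R) :
    \bar R :=
  if s == 0 then +oo%E else (diam C / (Num.sqrt (pi * s))%:E)%E.

(* Main.v *)
(* Unrolling the iteration at the larger index only, then at the smaller one
   only, bounds [|x_m - x_n|] and [|x_m - T x_n|] ([m <= n]) by a linear
   recursion that is solved by a survival probability: for a set of diameter
   [1], [|x_n - T x_n|] is at most the probability that a walk from [0], whose
   [i]-th step is [+1] or [-1] with probability [alpha i * (1 - alpha i)] each
   and [0] otherwise, stays nonnegative for [n] steps.  By reflection, this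
   probability is governed by the odd extension of its initial value, the sign
   function; Fourier series diagonalize the walk and give the integral over
   [[0, pi]] of
     [(1 + cos t) * \prod_i (1 - 2 * alpha i * (1 - alpha i) * (1 - cos t)) / pi].
   Since [1 - u <= exp (- u)], a Gaussian integral bounds it by
   [1 / sqrt (pi * \sum_i alpha i * (1 - alpha i))]. *)
Require Import Defs.
From HB Require Import structures.
From mathcomp Require Import all_boot all_order all_algebra.
From mathcomp Require Import all_classical all_reals all_analysis.
From mathcomp Require Import ring lra.

Set Implicit Arguments.
Unset Strict Implicit.
Unset Printing Implicit Defensive.

Import Order.TTheory GRing.Theory Num.Theory.
Import numFieldNormedType.Exports.

Local Open Scope classical_set_scope.
Local Open Scope ring_scope.

(** * The survival probability of the walk and its recursions *)

Section Survival.
Context {R : realType} (alpha : nat -> R).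

(* [surv m z] is the probability that a walk started at [z - 1] stays
   nonnegative when, for [i = m, ..., 1], its step is the difference of two
   independent Bernoulli variables of parameter [alpha i]. *)
Fixpoint surv (m z : nat) : R :=
  match m, z with
  | _, 0 => 0
  | 0, _.+1 => 1
  | m'.+1, z'.+1 =>
    let q := alpha m * (1 - alpha m) in
    q * surv m' z' + (1 - 2 * q) * surv m' z + q * surv m' z.+1
  end.

(* The expectation of [surv m (z + B)], where [B] is the sum of independent
   Bernoulli variables of parameters [alpha m.+1, ..., alpha (m + k)]. *)
Fixpoint head_start (m k z : nat) : R :=
  if k is k'.+1 then
    (1 - alpha (m + k)%N) * head_start m k' z +
    alpha (m + k)%N * head_start m k' z.+1
  else surv m z.

Arguments surv : simpl nomatch.

Lemma surv_z0 m : surv m 0 = 0.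
Proof. by case: m. Qed.

Lemma head_start_m0 k z : head_start 0 k z.+1 = 1.
Proof. by elim: k z => [//|k IH] z /=; rewrite !IH; ring. Qed.

(** Step [m.+1] of the walk is a difference of two Bernoulli variables: the added one joins the head
    start, the subtracted one moves [z.+1] to [z]. The start must be positive, since [surv] is
    absorbed at [0]. *)
Lemma head_startS m k z : head_start m.+1 k z.+1 =
  (1 - alpha m.+1) * head_start m k.+1 z.+1 + alpha m.+1 * head_start m k.+1 z.
Proof.
elim: k z => [|k IH] z; first by rewrite /= !addn1; ring.
rewrite [LHS]/= !IH.
have step n : head_start m k.+2 n = (1 - alpha (m.+1 + k.+1)%N) *
    head_start m k.+1 n + alpha (m.+1 + k.+1)%N * head_start m k.+1 n.+1.
  by rewrite [LHS]/= addSnnS.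
rewrite !step; ring.
Qed.

End Survival.

(** * Distances between iterates *)

Section Iterates.
Context {R : realType} {X : normedModType R}.

Lemma le_norm_convex_comb (a : R) (u v w : X) : 0 <= a <= 1 ->
  `|(1 - a) *: u + a *: v - w| <= (1 - a) * `|u - w| + a * `|v - w|.
Proof.
move=> /andP[a0 a1].
have -> : (1 - a) *: u + a *: v - w = (1 - a) *: (u - w) + a *: (v - w).
  rewrite !scalerBr addrACA -opprD -scalerDl.
  by rewrite subrK scale1r.
by rewrite (le_trans (ler_normD _ _))// !normrZ !ger0_norm// subr_ge0.
Qed.

Context (C : set X) (C_convex : convex_set C).
Context (T : X -> X) (T_maps : set_fun C C T).
Context (T_nonexp : forall x y : X, C x -> C y -> `|T x - T y| <= `|x - y|).
Context (alpha : nat -> R).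
Context (alpha01 : forall k : nat, (1 <= k)%N -> 0 <= alpha k <= 1).
Context (x0 : X) (x0C : C x0).
Local Notation x := (km_iter T alpha x0).

Lemma km_iter_in k : C (x k).
Proof.
elim: k => [//|k Ck] /=.
have /andP[a0 a1] : 0 <= alpha k.+1 <= 1 by exact: alpha01.
have l01 : Itv.spec (@Itv.num_sem R) (Itv.Real `[0%Z, 1%Z]) (alpha k.+1).
  by rewrite /= /Itv.num_sem/= in_itv/= a0 a1 ger0_real.
have := C_convex (Itv.mk l01) (mem_set (T_maps Ck)) (mem_set Ck).
by move=> /set_mem; rewrite addrC.
Qed.

Context (D : R) (D_diam : forall y z, C y -> C z -> `|y - z| <= D).

Lemma dist_km_iter_le m k : `|x (m + k)%N - x m| <= D * head_start alpha m k 0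
  /\ `|T (x (m + k)%N) - x m| <= D * head_start alpha m k 1.
Proof.
(* Unrolling the larger index reproduces the recursion defining [head_start]. *)
have from_T j :
    (forall l, `|T (x (j + l)%N) - x j| <= D * head_start alpha j l 1) ->
    forall l, `|x (j + l)%N - x j| <= D * head_start alpha j l 0.
  move=> HT; elim=> [|l IH].
    by rewrite addn0 subrr normr0 /= surv_z0 mulr0.
  have a01 : 0 <= alpha (j + l).+1 <= 1 by exact: alpha01.
  rewrite addnS [x _]/= (le_trans (le_norm_convex_comb _ _ _ a01))//.
  rewrite [head_start _ _ _ _]/= addnS mulrDr !(mulrCA D).
  by case/andP: a01 => a0 a1; rewrite lerD// ler_wpM2l// subr_ge0.
suff HT : forall l, `|T (x (m + l)%N) - x m| <= D * head_start alpha m l 1.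
  by split; [exact: from_T|].
elim: m {k} => [|m IH] l.
  by rewrite head_start_m0 mulr1 D_diam//; apply: T_maps; exact: km_iter_in.
have a01 : 0 <= alpha m.+1 <= 1 by exact: alpha01.
(* Unrolling [x m.+1] matches [head_startS]; non-expansiveness removes [T] from the second term,
   which [from_T] then bounds. *)
rewrite distrC [X in X - _]/= (le_trans (le_norm_convex_comb _ _ _ a01))//.
rewrite head_startS mulrDr !(mulrCA D).
case/andP: (a01) => a0 a1; rewrite addSnnS.
rewrite lerD// ler_wpM2l ?subr_ge0//; first by rewrite distrC.
apply: le_trans (T_nonexp _ _) _; [exact: km_iter_in..|].
by rewrite distrC from_T.
Qed.

Lemma residual_km_iter_le n : `|x n - T (x n)| <= D * surv alpha n 1.
Proof. by rewrite distrC; have [_] := dist_km_iter_le n 0; rewrite addn0. Qed.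

End Iterates.

(** * Integration over [[0, pi]] and the Fourier modes of the walk *)

Section KernelIntegral.
Context {R : realType}.
Implicit Types (f g : R -> R) (t a : R).

Local Notation mu := (@lebesgue_measure R).
Definition int0pi f : R := \int[mu]_(t in `[0, pi]) f t.

Lemma continuous_integrable0pi f :
  continuous f -> mu.-integrable `[0, pi] (EFin \o f).
Proof.
move=> cf; apply: continuous_compact_integrable; first exact: segment_compact.
exact: continuous_subspaceT.
Qed.

Lemma int0piD f g : continuous f -> continuous g ->
  int0pi (fun t => f t + g t) = int0pi f + int0pi g.
Proof.
by move=> cf cg; rewrite /int0pi RintegralD//; exact: continuous_integrable0pi.
Qed.

Lemma int0piZ a f : continuous f -> int0pi (fun t => a * f t) = a * int0pi f.
Proof.
by move=> cf; rewrite /int0pi RintegralZl//; exact: continuous_integrable0pi.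
Qed.

Lemma le_int0pi f g : continuous f -> continuous g ->
  (forall t, 0 <= t <= pi -> f t <= g t) -> int0pi f <= int0pi g.
Proof.
move=> cf cg fg; apply: le_Rintegral => //; exact: continuous_integrable0pi.
Qed.

Lemma int0pi_derive f F : continuous f ->
  (forall t, 0 <= t <= pi -> is_derive t 1 F (f t)) ->
  int0pi f = F pi - F 0.
Proof.
move=> cf dF; rewrite /int0pi /Rintegral (@continuous_FTC2 _ f F) ?pi_gt0//.
- exact: continuous_subspaceT.
- have cF t : 0 <= t <= pi -> {for t, continuous F}.
    by move=> /dF[dt _]; exact/differentiable_continuous/derivable1_diffP.
  split.
  + move=> t /[1!in_itv]/= /andP[t0 tpi].
    by have [] : is_derive t 1 F (f t) by apply: dF; rewrite !ltW.
  + by apply: cvg_at_right_filter; apply: cF; rewrite lexx pi_ge0.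
  + by apply: cvg_at_left_filter; apply: cF; rewrite lexx pi_ge0.
- move=> t /[1!in_itv]/= /andP[t0 tpi].
  have [_ <-] : is_derive t 1 F (f t) by apply: dF; rewrite !ltW.
  by rewrite derive1E.
Qed.

(* A closed form is [sin (z t) * cot (t / 2)], so that the integral below is
   the Fourier expansion of the sign of [z]. *)
Definition sgn_kernel (z : nat) t : R :=
  \sum_(j < z) (cos (j%:R * t) + cos (j.+1%:R * t)).

Lemma sgn_kernel0 t : sgn_kernel 0 t = 0.
Proof. by rewrite /sgn_kernel big_ord0. Qed.

Lemma sgn_kernel1 t : sgn_kernel 1 t = 1 + cos t.
Proof. by rewrite /sgn_kernel big_ord1 mul0r cos0 mul1r. Qed.

Lemma sgn_kernelS z t : sgn_kernel z.+1 t =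
  sgn_kernel z t + (cos (z%:R * t) + cos (z.+1%:R * t)).
Proof. by rewrite /sgn_kernel big_ord_recr. Qed.

Lemma cosD_cosB a t : cos (a + t) + cos (a - t) = 2 * cos t * cos a.
Proof. by rewrite cosB cosD; ring. Qed.

(** In [z], the kernel is an eigenvector of the neighbour sum, so a step of the walk multiplies it
    by [1 - 2 * q * (1 - cos t)]. *)
Lemma sgn_kernel_rec z t :
  sgn_kernel z t + sgn_kernel z.+2 t = 2 * cos t * sgn_kernel z.+1 t.
Proof.
elim: z => [|z IH].
  rewrite sgn_kernelS sgn_kernel1 sgn_kernel0 mul1r.
  have := cosD_cosB t t; rewrite subrr cos0.
  rewrite (_ : t + t = 2 * t) => [E|]; last by ring.
  have -> : cos (2 * t) = 2 * cos t * cos t - 1 by rewrite -E; ring.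
  by ring.
(* The increments of the kernel obey the same recurrence, by [cosD_cosB]. *)
rewrite (sgn_kernelS z) (sgn_kernelS z.+2) addrACA IH (sgn_kernelS z.+1) mulrDr.
congr +%R; rewrite mulrDr -!cosD_cosB.
have sub_t (n : nat) : n.+1%:R * t - t = n%:R * t by rewrite -natr1; ring.
have add_t (n : nat) : n%:R * t + t = n.+1%:R * t by rewrite -natr1; ring.
by rewrite !sub_t !add_t; ring.
Qed.

Lemma continuous_cosM a : continuous (fun t => cos (a * t)).
Proof.
move=> t; apply: continuous_comp; last exact: continuous_cos.
by apply: cvgMr; exact: cvg_id.
Qed.

Lemma continuous_sgn_kernel z : continuous (sgn_kernel z).
Proof.
elim: z => [|z IH].
  rewrite (_ : sgn_kernel 0 = cst 0); first exact: cst_continuous.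
  by apply/funext => t; exact: sgn_kernel0.
rewrite (funext (sgn_kernelS z)).
by move=> t; apply: cvgD; [exact: IH|apply: cvgD; exact: continuous_cosM].
Qed.

Lemma int0pi_cosn (n : nat) : int0pi (fun t => cos (n.+1%:R * t)) = 0.
Proof.
have n0 : n.+1%:R != 0 :> R by rewrite pnatr_eq0.
have dF t : 0 <= t <= pi ->
    is_derive t 1 (fun t => n.+1%:R^-1 * sin (n.+1%:R * t)) (cos (n.+1%:R * t)).
  move=> _; apply: trigger_derive; rewrite /GRing.scale/=; field.
  by rewrite addrC natr1.
rewrite (int0pi_derive _ dF); last exact: continuous_cosM.
rewrite mulr0 sin0.
suff -> : sin (n.+1%:R * pi) = 0 :> R by rewrite !mulr0 subrr.
elim: n {n0 dF} => [|n IH]; first by rewrite mul1r sinpi.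
by rewrite -natr1 mulrDl mul1r sinD IH sinpi; ring.
Qed.

Lemma int0pi_cst a : int0pi (fun=> a) = a * pi.
Proof.
have dF t : 0 <= t <= pi -> is_derive t 1 (fun t => a * t) a.
  by move=> _; apply: trigger_derive; rewrite /GRing.scale/=; ring.
by rewrite (int0pi_derive _ dF) ?mulr0 ?subr0//; exact: cst_continuous.
Qed.

(** Only the constant term [cos (0 * t)] has a nonzero integral. *)
Lemma int0pi_sgn_kernel z : int0pi (sgn_kernel z.+1) = pi.
Proof.
elim: z => [|z IH].
  rewrite (_ : sgn_kernel 1 = fun t => 1 + cos (1%:R * t)).
    rewrite int0piD ?int0pi_cst ?int0pi_cosn ?mul1r ?addr0//.
      exact: cst_continuous.
    exact: continuous_cosM.
  by apply/funext => t; rewrite sgn_kernel1 mul1r.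
rewrite (funext (sgn_kernelS z.+1)).
rewrite int0piD ?IH.
- rewrite int0piD ?int0pi_cosn ?addr0//; exact: continuous_cosM.
- exact: continuous_sgn_kernel.
- by move=> t; apply: cvgD; exact: continuous_cosM.
Qed.

(** * Integral formula for the survival probability *)

Section Weighted.
Context (alpha : nat -> R).

Let q i := alpha i * (1 - alpha i).

(** The characteristic function of the sum of steps [1] to [m]. *)
Definition damping (m : nat) t : R :=
  \prod_(1 <= i < m.+1) (1 - 2 * q i * (1 - cos t)).

Lemma continuous_damping m : continuous (damping m).
Proof.
move=> t; rewrite /damping; apply: cvg_big => //=; first exact: mul_continuous.
move=> i _; apply: cvgB; first exact: cvg_cst.
apply: cvgMr; apply: cvgB; first exact: cvg_cst.
exact: continuous_cos.
Qed.

(** Both sides satisfy the same recursion in [m], vanish at [z = 0] and equal [pi] at [m = 0],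
    [z > 0]. *)
Lemma surv_int0pi m z :
  pi * surv alpha m z = int0pi (fun t => sgn_kernel z t * damping m t).
Proof.
have cont z' m' : continuous (fun t => sgn_kernel z' t * damping m' t).
  move=> t; apply: cvgM; first exact: continuous_sgn_kernel.
  exact: continuous_damping.
have contZ a z' m' :
    continuous (fun t => a * (sgn_kernel z' t * damping m' t)).
  by move=> t; apply: cvgMr; exact: cont.
case: z => [|z].
  rewrite surv_z0 mulr0 -[LHS](mul0r pi) -(int0pi_cst 0).
  by congr int0pi; apply/funext => t; rewrite sgn_kernel0 mul0r.
elim: m z => [|m IH] z.
  rewrite /= mulr1 -(int0pi_sgn_kernel z); congr int0pi; apply/funext => t.
  by rewrite /damping big_geq ?mulr1.
rewrite [surv _ _ _]/= -/(q m.+1).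
have -> : (fun t => sgn_kernel z.+1 t * damping m.+1 t) = fun t =>
    q m.+1 * (sgn_kernel z t * damping m t) +
    ((1 - 2 * q m.+1) * (sgn_kernel z.+1 t * damping m t) +
     q m.+1 * (sgn_kernel z.+2 t * damping m t)).
  apply/funext => t; rewrite /damping big_nat_recr//=.
  have -> : sgn_kernel z.+2 t = 2 * cos t * sgn_kernel z.+1 t - sgn_kernel z t.
    by rewrite -sgn_kernel_rec; ring.
  by ring.
rewrite int0piD ?int0piD ?int0piZ//; last first.
  by move=> t; apply: cvgD; exact: contZ.
rewrite -!IH.
case: z => [|z]; last by rewrite -IH; ring.
have -> : (fun t => sgn_kernel 0 t * damping m t) = fun=> 0.
  by apply/funext => t; rewrite sgn_kernel0 mul0r.
by rewrite int0pi_cst surv_z0; ring.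
Qed.

Context (alpha01 : forall k : nat, (1 <= k)%N -> 0 <= alpha k <= 1).

Lemma damping_bounds m t :
  0 <= damping m t <= expR (- (2 * (1 - cos t) * \sum_(1 <= i < m.+1) q i)).
Proof.
have c1 := cos_le1 t; have cN1 := cos_geN1 t.
elim: m => [|m /andP[d0 dle]].
  by rewrite /damping !big_geq// mulr0 oppr0 expR0 ler01 lexx.
(* With [1 - cos t <= 2], the bound [4 * q <= 1] makes each factor nonnegative, so the upper bounds
   can be multiplied. *)
have [q0 q4] : 0 <= q m.+1 /\ 4 * q m.+1 <= 1.
  have /andP[a0 a1] : 0 <= alpha m.+1 <= 1 by exact: alpha01.
  split; first by rewrite mulr_ge0// subr_ge0.
  rewrite -subr_ge0 (_ : _ - _ = (1 - 2 * alpha m.+1) ^+ 2) ?sqr_ge0//.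
  by rewrite /q; ring.
have f0 : 0 <= 1 - 2 * q m.+1 * (1 - cos t).
  have : 0 <= q m.+1 * (1 + cos t) by rewrite mulr_ge0//; lra.
  by nra.
have -> : damping m.+1 t = damping m t * (1 - 2 * q m.+1 * (1 - cos t)).
  by rewrite /damping big_nat_recr.
have -> : \sum_(1 <= i < m.+2) q i = \sum_(1 <= i < m.+1) q i + q m.+1.
  by rewrite big_nat_recr.
rewrite (mulrDr (2 * (1 - cos t))) opprD expRD mulr_ge0//= ler_pM//.
rewrite (_ : 1 - _ = 1 + - (2 * (1 - cos t) * q m.+1)) ?expR_ge1Dx//.
by ring.
Qed.

End Weighted.

(** * Comparison with the Gaussian integral *)

(* The lower bound [-1] makes this differentiable at [0]. *)
Local Notation gauss_primitive :=
  (fun x : R => \int[mu]_(t in `[-1, x]) gauss_fun t).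

Lemma gauss_primitive_derive (x : R) : -1 < x ->
  is_derive x 1 gauss_primitive (gauss_fun x).
Proof.
move=> x1; have xx1 : x < x + 1 by rewrite ltrDl.
have [] := @continuous_FTC1_closed R gauss_fun (-1) x (x + 1) xx1 _ x1 _.
- by apply: integrableS integrableT_gauss.
- exact: continuous_gauss_fun.
- by move=> d e; split => //; rewrite -derive1E.
Qed.

Lemma gauss_primitive_le (x : R) : 0 <= x ->
  gauss_primitive x - gauss_primitive 0 <= Num.sqrt pi / 2.
Proof.
move=> x0; have ig A : measurable A -> mu.-integrable A (EFin \o gauss_fun).
  by move=> mA; apply: integrableS integrableT_gauss.
rewrite Rintegral_itvB ?bnd_simp//; last exact: ig.
have <- : \int[mu]_(t in `[0, +oo[) gauss_fun t = Num.sqrt pi / 2.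
  by rewrite /Rintegral integral0y_gauss.
rewrite /Rintegral fine_le//.
- exact: integrable_fin_num (ig _ _).
- exact: integrable_fin_num (ig _ _).
- apply: ge0_subset_integral => //.
  + exact: measurable_int (ig _ _).
  + by move=> t _; rewrite lee_fin gauss_fun_ge0.
  + by move=> t /=; rewrite !in_itv/= andbT => /andP[/ltW].
Qed.

(* With [v = sin (t / 2)] the left-hand side is the integral over [0, 1] of
   [4 sqrt (1 - v^2) exp (- 4 s v^2)]; bounding the square root by [1] leaves a
   Gaussian integral. *)
Lemma int0pi_gauss_le (s : R) : 0 < s ->
  int0pi (fun t => (1 + cos t) * expR (- (2 * (1 - cos t) * s))) <=
  Num.sqrt pi / Num.sqrt s.
Proof.
move=> s0; set r : R := Num.sqrt s.
have r0 : 0 < r by rewrite sqrtr_gt0.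
have rr : r ^+ 2 = s by rewrite sqr_sqrtr// ltW.
have cos_half t : cos t = 1 - 2 * sin (t / 2) ^+ 2.
  have {1}-> : t = t / 2 + t / 2 by field.
  by rewrite cosD -!expr2 cos2sin2; ring.
(* On [[0, pi]], [h] dominates the integrand because [1 + cos t = 2 * cos (t / 2) ^+ 2 <= 2 * cos (t
   / 2)]; the substitution [u = 2 * r * sin (t / 2)] gives its primitive [H]. *)
pose h t := 2 * cos (t / 2) * gauss_fun (2 * r * sin (t / 2)).
pose H t : R := 2 / r * gauss_primitive (2 * r * sin (t / 2)).
have dH t : 0 <= t <= pi -> is_derive t 1 H (h t).
  move=> /andP[t0 tpi].
  have dsin : is_derive t 1 (fun t => 2 * r * sin (t / 2)) (r * cos (t / 2)).
    by apply: trigger_derive; rewrite /GRing.scale/=; field.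
  have r1 : -1 < 2 * r * sin (t / 2).
    have sin_ge0 : 0 <= sin (t / 2) by rewrite sin_ge0_pi//; lra.
    by rewrite (lt_le_trans (ltrN10 _))// mulr_ge0// mulr_ge0// ltW.
  have dcomp := @is_derive1_comp _ gauss_primitive
    (fun t => 2 * r * sin (t / 2)) t _ _ (gauss_primitive_derive r1) dsin.
  have := is_deriveZ (2 / r) dcomp.
  rewrite (_ : _ *: _ = h t)//.
  by rewrite /GRing.scale/= /h; field; rewrite gt_eqF.
have ch : continuous h.
  move=> t; apply/differentiable_continuous/derivable1_diffP.
  by rewrite /h /gauss_fun; exact: ex_derive.
have -> : Num.sqrt pi / r = 2 / r * (Num.sqrt pi / 2) by field; rewrite gt_eqF.
apply: (@le_trans _ _ (int0pi h)).
  apply: le_int0pi => //.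
    move=> t; apply/differentiable_continuous/derivable1_diffP.
    exact: ex_derive.
  move=> t /andP[t0 tpi]; rewrite /h /gauss_fun exprMn exprMn rr.
  have -> : 2 ^+ 2 * s * sin (t / 2) ^+ 2 = 2 * (1 - cos t) * s.
    by rewrite (cos_half t); ring.
  rewrite ler_wpM2r ?expR_ge0//.
  have c0 : 0 <= cos (t / 2) by rewrite cos_ge0_pihalf//; lra.
  have c1 := cos_le1 (t / 2).
  by rewrite cos_half sin2cos2; nra.
rewrite (int0pi_derive ch dH) /H mul0r sin0 mulr0 sin_pihalf mulr1 -mulrBr.
rewrite ler_wpM2l//; first by rewrite divr_ge0// ltW.
by rewrite gauss_primitive_le// mulr_ge0// ltW.
Qed.

Lemma surv1_le (alpha : nat -> R) n :
  (forall k : nat, (1 <= k)%N -> 0 <= alpha k <= 1) ->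
  let s := \sum_(1 <= i < n.+1) alpha i * (1 - alpha i) in
  0 < s -> surv alpha n 1 <= (Num.sqrt (pi * s))^-1.
Proof.
move=> alpha01 s s0.
have : pi * surv alpha n 1 <= Num.sqrt pi / Num.sqrt s.
  rewrite surv_int0pi; apply: le_trans (int0pi_gauss_le s0).
  apply: le_int0pi.
  - move=> t; apply: cvgM; first exact: continuous_sgn_kernel.
    exact: continuous_damping.
  - move=> t; apply/differentiable_continuous/derivable1_diffP.
    exact: ex_derive.
  - move=> t _; have /andP[_ dle] := damping_bounds alpha01 n t.
    by rewrite sgn_kernel1 ler_wpM2l// -lerBlDl sub0r cos_geN1.
have spi : 0 < Num.sqrt pi :> R by rewrite sqrtr_gt0 pi_gt0.
rewrite -ler_pdivlMl ?pi_gt0// => /le_trans; apply.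
rewrite sqrtrM ?pi_ge0// -{1}(@sqr_sqrtr _ pi) ?pi_ge0//.
rewrite le_eqVlt; apply/orP; left; apply/eqP; field.
by rewrite (gt_eqF spi) gt_eqF// sqrtr_gt0.
Qed.

End KernelIntegral.

Theorem theorem1 (R : realType) (X : normedModType R) (C : set X)
    (C_nonempty : C !=set0) (C_convex : convex_set C)
    (T : X -> X) (T_maps : set_fun C C T)
    (T_nonexp : forall x y : X, C x -> C y -> `|T x - T y| <= `|x - y|)
    (alpha : nat -> R)
    (alpha01 : forall k : nat, (1 <= k)%N -> 0 <= alpha k <= 1)
    (x0 : X) (x0C : C x0) (n : nat) (n_ge1 : (1 <= n)%N) :
  (`|km_iter T alpha x0 n - T (km_iter T alpha x0 n)|%:E <=
     km_bound C (\sum_(1 <= i < n.+1) alpha i * (1 - alpha i)))%E.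
Proof.
rewrite /km_bound; set s := \sum_(_ <= _ < _) _.
case: eqVneq => [_|s_neq0]; first exact: leey.
have s_gt0 : 0 < s.
  rewrite lt_neqAle eq_sym s_neq0 /s big_nat_cond sumr_ge0// => i.
  move=> /andP[/andP[i1 _] _].
  by have /andP[a0 a1] := alpha01 i i1; rewrite mulr_ge0// subr_ge0.
have sqrt_gt0 : 0 < Num.sqrt (pi * s) by rewrite sqrtr_gt0 mulr_gt0// pi_gt0.
have le_diam y z : C y -> C z -> (`|y - z|%:E <= diam C)%E.
  by move=> Cy Cz; apply: ereal_sup_ubound; exists (y, z).
rewrite inver gt_eqF//.
(* An infinite diameter makes the bound [+oo]; the value [-oo] is excluded by [x0] in [C]. *)
case: (diam C) le_diam => [D||] le_diam.
- have D_diam y z : C y -> C z -> `|y - z| <= D.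
    by move=> Cy Cz; rewrite -lee_fin le_diam.
  rewrite -EFinM lee_fin.
  have := residual_km_iter_le C_convex T_maps T_nonexp alpha01 x0C D_diam n.
  move=> /le_trans; apply.
  rewrite ler_wpM2l ?surv1_le//.
  by rewrite (le_trans (normr_ge0 _) (D_diam _ _ x0C x0C)).
- by rewrite gt0_mulye ?leey// lte_fin invr_gt0.
- by have := le_diam _ _ x0C x0C; rewrite leeNy_eq.
Qed.
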